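(* Let $\mathcal{G}=(\mathcal{V},\mathcal{E})$ be a regular cell graph. For a smooth $\mathbf{Z}_2$-invariant function $\phi:\mathbb{R}^2\to\mathbb{R}$ let $$f(x)=\sum_{e\in\mathcal{E}}\phi(x_{\rho(e)},x_{\tau(e)}),\qquad x\in\mathbb{R}^{n},\ n=|\mathcal{V}|.$$ Then $f$ has a minimum at $x^0=(x_0,\dots,x_0)$ if the coupling function $\phi$ has a minimum at $(x_0,x_0)$. The converse (that, for every such $\phi$ and $x_0\in\mathbb{R}$, $f$ having a minimum at $(x_0,\dots,x_0)$ implies that $\phi$ has a minimum at $(x_0,x_0)$) holds if and only if $\mathcal{G}$ is bipartite.
   Context: A cell graph is a finite connected undirected graph without multiple edges; loops are disregarded, so $\mathcal{E}$ is the set of edges joining distinct vertices. It is regular if all vertices have the same degree $d\ge 1$. Each vertex $v$ carries a one-dimensional variable $x_v\in\mathbb{R}$. For an edge $e$, $\rho(e)$ and $\tau(e)$ denote its two endpoints (the order is irrelevant since $\phi$ is symmetric). $\mathbf{Z}_2$-invariant means $\phi(x,y)=\phi(y,x)$ for all $x,y$. ''Minimum'' means local minimum. *)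

(* Defs.v *)
From HB Require Import structures.
From mathcomp Require Import all_boot all_order all_algebra.
From mathcomp Require Import all_classical all_reals all_analysis.

Set Implicit Arguments.
Unset Strict Implicit.
Unset Printing Implicit Defensive.

Import Order.TTheory GRing.Theory Num.Theory numFieldNormedType.Exports.

Local Open Scope ring_scope.

(* Loops being disregarded, a cell graph is a simple graph, given by its
   adjacency relation; connectedness includes having at least one vertex. *)
Definition cell_graph (V : finType) (adj : rel V) : Prop :=
  [/\ symmetric adj, irreflexive adj, (0 < #|V|)%N
    & forall u v : V, connect adj u v].

Definition degree (V : finType) (adj : rel V) (v : V) : nat :=
  #|[pred w | adj v w]|.

Definition regular (V : finType) (adj : rel V) (d : nat) : Prop :=
  forall v : V, degree adj v = d.

Definition bipartite (V : finType) (adj : rel V) : Prop :=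
  exists side : V -> bool, forall u v : V, adj u v -> side u != side v.

(* An edge is the two-element set of its endpoints, so that every undirected
   edge occurs exactly once. *)
Definition edges (V : finType) (adj : rel V) : {set {set V}} :=
  [set [set u; v] | u in V, v in adj u]%SET.

Definition endpoint_maps (V : finType) (adj : rel V)
    (rho tau : {set V} -> V) : Prop :=
  forall e : {set V}, e \in edges adj -> e = [set rho e; tau e]%SET.

(* The vertices are numbered by enum_rank: the point x of R^n, n = #|V|, has
   the coordinate x_v in the column of index enum_rank v. *)
Definition cell_coord (R : realType) (V : finType) (x : 'rV[R]_#|V|) (v : V)
  : R := x ord0 (enum_rank v).

Definition network_fun (R : realType) (V : finType) (adj : rel V)
    (rho tau : {set V} -> V) (phi : R * R -> R) (x : 'rV[R]_#|V|) : R :=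
  \sum_(e in edges adj) phi (cell_coord x (rho e), cell_coord x (tau e)).

Definition Z2_invariant (R : realType) (phi : R * R -> R) : Prop :=
  forall x y : R, phi (x, y) = phi (y, x).

Fixpoint Ck (R : realType) (k : nat) (phi : R * R -> R) : Prop :=
  continuous phi /\
  if k is k'.+1 then
    [/\ forall p : R * R, derivable phi p (1, 0),
        forall p : R * R, derivable phi p (0, 1),
        Ck k' ('D_(1, 0) phi)
      & Ck k' ('D_(0, 1) phi)]
  else True.

Definition smooth (R : realType) (phi : R * R -> R) : Prop :=
  forall k : nat, Ck k phi.

Definition local_min (R : realType) (T : topologicalType) (f : T -> R) (a : T)
  : Prop := \forall x \near a, f a <= f x.

(* Main.v *)
Require Import Defs.
From mathcomp Require Import all_boot all_order all_algebra.
From mathcomp Require Import all_classical all_reals all_analysis.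
From mathcomp Require Import lra.
Import Order.TTheory GRing.Theory Num.Theory numFieldNormedType.Exports.

(** A sum of functions that are each minimal at the same point is minimal
    there; as every edge term reads two coordinates that tend to [x0] together,
    a minimum of [phi] passes to the network function
    ([network_fun_local_min]).

    On a bipartite graph the network function contains a copy of [phi]: the
    vector equal to [a] on one side and to [b] on the other puts [phi (a, b)]
    or [phi (b, a)] on every edge, so its value is the number of edges times
    [phi (a, b)], and minimality of the sum is minimality of [phi]
    ([bipartite_local_min]).

    On a connected graph that is not bipartite, a quadratic saddle refutes the
    converse.  Let [Q] be the quadratic form of the signless Laplacian, the sum
    over the edges [uv] of the squares of [x u + x v].  It is positive
    definite: through every vertex [v] passes an odd closed walk
    ([odd_closed_walk]), along which the alternating sum of the numbers
    [x s + x t] telescopes to [2 x v], so that [Q = 0] forces [x v = 0], with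
    the explicit estimate [|x v| <= #|V| * sqrt Q] of [signless_coercive].
    Hence [K Q] dominates the sum of the products [x u * x v] once [K] is large
    enough, and the coupling [K (x + y)^2 + x y] makes the network function
    nonnegative, with value 0 at the origin ([network_saddle_local_min]).  The
    coupling itself takes the value [- t^2] at [(t, - t)]
    ([saddle_not_local_min]). *)

Set Implicit Arguments.
Unset Strict Implicit.

Local Open Scope ring_scope.

(** * Edges and their endpoints *)

Lemma edge_endpoints (V : finType) (adj : rel V) (rho tau : {set V} -> V)
    (u v : V) (e := [set u; v]%SET) :
  irreflexive adj -> endpoint_maps adj rho tau -> adj u v ->
  e \in edges adj /\
  (rho e = u /\ tau e = v \/ rho e = v /\ tau e = u).
Proof.
move=> adjxx hends uv.
have he : e \in edges adj by apply/imset2P; exists u v.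
split=> //; have eE := hends _ he.
have uNv : u != v by apply: contraTneq uv => ->; rewrite adjxx.
have : u \in [set rho e; tau e]%SET by rewrite -eE set21.
have : v \in [set rho e; tau e]%SET by rewrite -eE set22.
rewrite !inE => /orP[] /eqP ve /orP[] /eqP ue.
- by move: uNv; rewrite ue ve eqxx.
- by right.
- by left.
- by move: uNv; rewrite ue ve eqxx.
Qed.

Lemma adj_endpoints (V : finType) (adj : rel V) (rho tau : {set V} -> V)
    (e : {set V}) :
  symmetric adj -> irreflexive adj -> endpoint_maps adj rho tau ->
  e \in edges adj -> adj (rho e) (tau e).
Proof.
move=> adjC adjxx hends /imset2P[u v _ /= uv ->].
change (is_true (adj u v)) in uv.
have [_ [[-> ->]|[-> ->]]] := edge_endpoints adjxx hends uv => //.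
by rewrite adjC.
Qed.

Lemma edge_term_le_sum (R : realType) (V : finType) (adj : rel V)
    (rho tau : {set V} -> V) (F : V -> V -> R) (u v : V) :
  irreflexive adj -> endpoint_maps adj rho tau ->
  (forall a b, 0 <= F a b) -> (forall a b, F a b = F b a) -> adj u v ->
  F u v <= \sum_(e in edges adj) F (rho e) (tau e).
Proof.
move=> adjxx hends F0 FC uv.
have [he ends] := edge_endpoints adjxx hends uv.
rewrite (bigD1 [set u; v]%SET) //=.
suff -> : F u v = F (rho [set u; v]%SET) (tau [set u; v]%SET).
  by rewrite lerDl sumr_ge0.
by case: ends => -[-> ->].
Qed.

(** * Passing minimality between the coupling and the network *)

Lemma network_fun_local_min (R : realType) (V : finType) (adj : rel V)
    (rho tau : {set V} -> V) (phi : R * R -> R) (x0 : R) :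
  local_min phi (x0, x0) ->
  local_min (network_fun adj rho tau phi) (const_mx x0).
Proof.
move=> hphi.
have near_edge (e : {set V}) : \forall x \near (const_mx x0 : 'rV[R]_#|V|),
    phi (x0, x0) <= phi (cell_coord x (rho e), cell_coord x (tau e)).
  have coord_cvg v : (@cell_coord R V x v @[x --> const_mx x0] --> x0)%classic.
    have := @coord_continuous R 1 #|V| ord0 (enum_rank v) (const_mx x0).
    by rewrite /continuous_at mxE.
  exact: (cvg_pair (coord_cvg (rho e)) (coord_cvg (tau e))) hphi.
apply: filterS (filter_forall _ near_edge) => x hx; apply: ler_sum => e _.
by rewrite /cell_coord !mxE; exact: hx.
Qed.

Lemma bipartite_local_min (R : realType) (V : finType) (adj : rel V)
    (rho tau : {set V} -> V) (phi : R * R -> R) (x0 : R) :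
  symmetric adj -> irreflexive adj -> endpoint_maps adj rho tau ->
  (0 < #|edges adj|)%N -> bipartite adj -> Z2_invariant phi ->
  local_min (network_fun adj rho tau phi) (const_mx x0) ->
  local_min phi (x0, x0).
Proof.
move=> adjC adjxx hends edge_gt0 [side hside] phiC /nbhs_ballP[r r0 hr].
apply/nbhs_ballP; exists r => // -[a b] [/= ha hb].
(* The sides of the bipartition carry the values [a] and [b]. *)
pose y : 'rV[R]_#|V| := \row_j (if side (enum_val j) then a else b).
have /hr /= : ball (const_mx x0 : 'rV[R]_#|V|) r y.
  by split=> // i j; rewrite !mxE; case: ifP.
rewrite /network_fun.
under eq_bigr do rewrite /cell_coord !mxE.
under [leRHS]eq_bigr => e he.
  have -> : phi (cell_coord y (rho e), cell_coord y (tau e)) = phi (a, b).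
    have := hside _ _ (adj_endpoints adjC adjxx hends he).
    rewrite /cell_coord !mxE !enum_rankK.
    by case: (side (rho e)); case: (side (tau e)).
  over.
by rewrite !sumr_const ler_pMn2r.
Qed.

(** * Odd closed walks in graphs that are not bipartite *)

(** The bipartite double cover: a walk in it is a walk of the graph together
    with the parity of its length, which turns the existence of odd closed walks
    into a connectivity question. *)
Definition double_cover (V : finType) (adj : rel V) : rel (V * bool) :=
  fun p q => adj p.1 q.1 && (p.2 != q.2).

Lemma double_coverC (V : finType) (adj : rel V) :
  symmetric adj -> symmetric (double_cover adj).
Proof. by move=> adjC p q; rewrite /double_cover adjC eq_sym. Qed.

(** Exchanging the two sheets is an automorphism of the cover. *)
Lemma connect_double_cover_flip (V : finType) (adj : rel V) (u v : V)
    (b c : bool) :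
  connect (double_cover adj) (u, b) (v, c) ->
  connect (double_cover adj) (u, ~~ b) (v, ~~ c).
Proof.
case/connectP=> p; elim: p u b => [|[w d] p IH] u b /=.
  by move=> _ [-> ->].
case/andP=> uw hp hl; apply: connect_trans (IH _ _ hp hl); apply: connect1.
by case/andP: uw => /= uw bd; rewrite /double_cover /= uw (inj_eq negb_inj).
Qed.

Lemma connect_double_cover_lift (V : finType) (adj : rel V) (u v : V)
    (b : bool) :
  connect adj u v -> exists c, connect (double_cover adj) (u, b) (v, c).
Proof.
case/connectP=> p; elim: p u b => [|w p IH] u b /=.
  by move=> _ ->; exists b.
case/andP=> uw hp hl; have [c hc] := IH _ (~~ b) hp hl.
exists c; apply: connect_trans hc; apply: connect1.
by rewrite /double_cover /= uw; case: b.
Qed.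

(** If the two lifts of some [v] lie in different components, then by
    exchanging the sheets every vertex has exactly one lift in the component of
    [(v, false)].  The sheet of that lift changes along every edge, hence is a
    2-colouring. *)
Lemma odd_closed_walk (V : finType) (adj : rel V) (v : V) :
  symmetric adj -> (forall u w : V, connect adj u w) -> ~ bipartite adj ->
  connect (double_cover adj) (v, false) (v, true).
Proof.
move=> adjC conn nbip; apply: contra_notT nbip => sheets.
have CC : connect_sym (double_cover adj).
  exact/sym_connect_sym/double_coverC.
pose C := connect (double_cover adj) (v, false).
have one_lift u : C (u, true) = ~~ C (u, false).
  case Cf: (C (u, false)) => /=.
    apply: contraNF sheets => Ct; apply: connect_trans Ct _.
    by rewrite CC; exact: connect_double_cover_flip Cf.
  have [[//|]] := connect_double_cover_lift false (conn v u).
  by rewrite -/(C _) Cf.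
have step u w b : adj u w -> C (u, b) -> C (w, ~~ b).
  move=> uw Cu; apply: connect_trans Cu _; apply: connect1.
  by rewrite /double_cover /= uw; case: b.
exists (fun u => C (u, true)) => u w uw.
case Cu: (C (u, true)).
  by rewrite one_lift (step _ _ _ uw Cu).
have {}Cu : C (u, false) by move: Cu; rewrite one_lift => /negbFE.
by rewrite (step _ _ _ uw Cu).
Qed.

(** * Coercivity of the signless Laplacian *)

(** With the sign [(-1) ^ b] attached to the sheet [b], each step of a walk in
    the cover changes the signed value by [x s + x t] up to sign, and the
    differences telescope. *)
Lemma double_cover_walk_bound (R : realType) (V : finType) (adj : rel V)
    (x : V -> R) (m : R) (u : V) (b : bool) (p : seq (V * bool)) :
  (forall s t, adj s t -> `|x s + x t| <= m) ->
  path (double_cover adj) (u, b) p ->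
  let q := last (u, b) p in
  `|(-1) ^+ b * x u - (-1) ^+ q.2 * x q.1| <= m *+ size p.
Proof.
move=> hm; elim: p u b => [|[w c] p IH] u b /=; first by rewrite subrr normr0.
case/andP=> /andP[/= uw bc] /IH /= IHp; rewrite mulrS.
apply: le_trans (lerD (hm _ _ uw) IHp).
have -> : `|x u + x w| = `|(-1) ^+ b * x u - (-1) ^+ c * x w|.
  case: b c bc {IHp} => [] [] //= _; rewrite ?expr0 ?expr1 ?mul1r ?mulN1r.
    by rewrite -opprD normrN.
  by rewrite opprK.
by rewrite (le_trans _ (ler_normD _ _)) // addrA subrK.
Qed.

(** An odd closed walk through [v] has end values [x v] and [- x v], so it
    bounds [2 * |x v|] by its length times [m].  Removing repetitions in the
    cover keeps the length below the number [2 * #|V|] of its vertices. *)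
Lemma signless_coercive (R : realType) (V : finType) (adj : rel V)
    (x : V -> R) (m : R) (v : V) :
  symmetric adj -> (forall u w : V, connect adj u w) -> ~ bipartite adj ->
  (forall s t, adj s t -> `|x s + x t| <= m) -> 0 <= m ->
  `|x v| <= #|V|%:R * m.
Proof.
move=> adjC conn nbip hm m0.
have /connectP[p0 hp0] := odd_closed_walk v adjC conn nbip.
case/shortenP: hp0 => p hp Up _ lastp.
have := double_cover_walk_bound hm hp.
rewrite -lastp /= expr0 expr1 mul1r mulN1r opprK -mulr2n normrMn => hx.
have szp : (size p <= #|V| * 2)%N.
  rewrite -card_bool -card_prod; apply: ltnW.
  by have := max_card [in (v, false) :: p]; rewrite (card_uniqP Up).
rewrite -(ler_pMn2r (n := 2)) // (le_trans hx) //.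
by rewrite mulr_natl -mulrnA ler_wpMn2l.
Qed.

(** * Smoothness of polynomial functions of two variables *)

Inductive polynomial_fun (R : realType) : (R * R -> R) -> Prop :=
| polynomial_cst c : polynomial_fun (cst c)
| polynomial_fst : polynomial_fun fst
| polynomial_snd : polynomial_fun snd
| polynomial_add f g :
    polynomial_fun f -> polynomial_fun g -> polynomial_fun (f \+ g)
| polynomial_mul f g :
    polynomial_fun f -> polynomial_fun g -> polynomial_fun (f \* g).

Lemma polynomial_continuous (R : realType) (f : R * R -> R) :
  polynomial_fun f -> continuous f.
Proof.
elim=> {f} [c|||f g _ hf _ hg|f g _ hf _ hg] p.
- exact: cvg_cst.
- exact: cvg_fst.
- exact: cvg_snd.
- exact: cvgD (hf p) (hg p).
- exact: cvgM (hf p) (hg p).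
Qed.

Lemma is_derive_linear (R : numFieldType) (U W : normedModType R)
    (f : {linear U -> W}) (p v : U) :
  continuous f -> is_derive p v f (f v).
Proof.
move=> cf; have df := linear_differentiable p cf.
by apply: DeriveDef; [exact: diff_derivable | rewrite deriveE // diff_lin].
Qed.

Lemma polynomial_derive (R : realType) (v : R * R) (f : R * R -> R) :
  polynomial_fun f ->
  exists2 df, polynomial_fun df & forall p, is_derive p v f (df p).
Proof.
elim=> {f} [c|||f g Pf [df Pdf hf] Pg [dg Pdg hg]
  |f g Pf [df Pdf hf] Pg [dg Pdg hg]].
- exists (cst 0); first exact: polynomial_cst.
  by move=> p; exact: is_derive_cst.
- exists (cst v.1); first exact: polynomial_cst.
  move=> p; have := polynomial_continuous (polynomial_fst R).
  exact: (@is_derive_linear R _ _ fst p v).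
- exists (cst v.2); first exact: polynomial_cst.
  move=> p; have := polynomial_continuous (polynomial_snd R).
  exact: (@is_derive_linear R _ _ snd p v).
- exists (df \+ dg); first exact: polynomial_add.
  by move=> p; exact: is_deriveD.
- exists ((f \* dg) \+ (g \* df)).
    by apply: polynomial_add; exact: polynomial_mul.
  by move=> p; exact: is_deriveM.
Qed.

(** Polynomial functions are continuous and closed under partial derivatives,
    so continuity propagates to all orders. *)
Lemma polynomial_smooth (R : realType) (f : R * R -> R) :
  polynomial_fun f -> smooth f.
Proof.
move=> Pf k; elim: k f Pf => [|k IH] f Pf /=.
  by split=> //; exact: polynomial_continuous.
split; first exact: polynomial_continuous.
have part v : (forall p, derivable f p v) /\ Ck k ('D_v f).
  have [df Pdf hdf] := polynomial_derive v Pf.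
  split=> [p|]; first exact: (@ex_derive _ _ _ _ _ _ _ (hdf p)).
  suff -> : 'D_v f = df by exact: IH.
  by apply/funext => p; exact: (@derive_val _ _ _ _ _ _ _ (hdf p)).
by split; [have [] := part (1, 0) | have [] := part (0, 1)
  | have [] := part (1, 0) | have [] := part (0, 1)].
Qed.

(** * The saddle coupling *)

(** The eigenvalues of this form are [2 K + 1 / 2] in the direction [(1, 1)]
    and [- 1 / 2] in the direction [(1, -1)].  For [K >= 0] it is negative only
    where the two arguments have opposite signs, which cannot happen on all
    edges of a graph that is not bipartite. *)
Definition saddle (R : realType) (K : R) (p : R * R) : R :=
  K * (p.1 + p.2) ^+ 2 + p.1 * p.2.

Lemma saddle_smooth (R : realType) (K : R) : smooth (saddle K).
Proof.
apply: polynomial_smooth.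
have Ps : @polynomial_fun R (fst \+ snd).
  by apply: polynomial_add; [exact: polynomial_fst | exact: polynomial_snd].
apply: (@polynomial_add R (cst K \* ((fst \+ snd) \* (fst \+ snd))) (fst \* snd)).
  apply: polynomial_mul; [exact: polynomial_cst | exact: polynomial_mul].
by apply: polynomial_mul; [exact: polynomial_fst | exact: polynomial_snd].
Qed.

Lemma saddle_not_local_min (R : realType) (K : R) :
  ~ local_min (saddle K) (0, 0).
Proof.
move=> /nbhs_ballP[r /= r0 hr].
have : saddle K (0, 0) <= saddle K (r / 2, - (r / 2)).
  apply: hr; split; rewrite /ball /= sub0r ?opprK ?normrN gtr0_norm; lra.
rewrite /saddle /=; nra.
Qed.

(** The coefficient is dictated by coercivity: each product [x u * x v] is at
    least [- #|V|^2 Q], and there is one for each edge. *)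
Lemma network_saddle_local_min (R : realType) (V : finType) (adj : rel V)
    (rho tau : {set V} -> V) :
  symmetric adj -> irreflexive adj -> (forall u v : V, connect adj u v) ->
  endpoint_maps adj rho tau -> ~ bipartite adj ->
  local_min (network_fun adj rho tau (saddle (#|V|%:R ^+ 2 *+ #|edges adj|)))
    (const_mx (0 : R)).
Proof.
move=> adjC adjxx conn hends nbip; rewrite /local_min; near=> y.
pose x v := cell_coord y v; set N : R := #|V|%:R.
have -> : network_fun adj rho tau (saddle (N ^+ 2 *+ #|edges adj|))
    (const_mx 0) = 0.
  by apply: big1 => e _; rewrite /saddle /cell_coord !mxE /= addr0 expr0n /=
    !mulr0 addr0.
pose Q := \sum_(e in edges adj) (x (rho e) + x (tau e)) ^+ 2.
have Q0 : 0 <= Q by apply: sumr_ge0 => e _; exact: sqr_ge0.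
have xN v : `|x v| <= N * Num.sqrt Q.
  apply: signless_coercive adjC conn nbip _ (sqrtr_ge0 _) => s t st.
  rewrite -sqrtr_sqr ler_wsqrtr //.
  apply: (edge_term_le_sum (F := fun a b => (x a + x b) ^+ 2)) st => //.
    by move=> a b; exact: sqr_ge0.
  by move=> a b; rewrite addrC.
rewrite /network_fun /saddle big_split /= -mulr_sumr -/Q.
have : \sum_(e in edges adj) - (N ^+ 2 * Q)
    <= \sum_(e in edges adj) x (rho e) * x (tau e).
  apply: ler_sum => e _; rewrite lerNl (le_trans (ler_norm _)) //.
  rewrite normrN normrM -[Q]sqr_sqrtr // -exprMn expr2.
  exact: ler_pM.
rewrite sumr_const mulNrn => h.
by rewrite mulrnAl -lerBlDl sub0r.
Unshelve. all: by end_near.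
Qed.

Unset Implicit Arguments.

Theorem corollary3p2 (R : realType) (V : finType) (adj : rel V) (d : nat)
    (rho tau : {set V} -> V) (hG : cell_graph adj) (hd : (1 <= d)%N)
    (hreg : regular adj d) (hends : endpoint_maps adj rho tau) :
  (forall phi : R * R -> R, smooth phi -> Z2_invariant phi ->
     forall x0 : R, local_min phi (x0, x0) ->
       local_min (network_fun adj rho tau phi) (const_mx x0)) /\
  ((forall phi : R * R -> R, smooth phi -> Z2_invariant phi ->
      forall x0 : R,
        local_min (network_fun adj rho tau phi) (const_mx x0) ->
        local_min phi (x0, x0))
   <-> bipartite adj).
Proof.
have [adjC adjxx V0 conn] := hG.
split=> [phi _ _ x0|]; first exact: network_fun_local_min.
split=> [conv|bip phi _ phiC x0]; last first.
  apply: bipartite_local_min => //.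
  case/card_gt0P: V0 => v _.
  move: hd; rewrite -(hreg v) => /card_gt0P[w]; rewrite inE => vw.
  by apply/card_gt0P; exists [set v; w]%SET; apply/imset2P; exists v w.
apply: contrapT => nbip.
(* Positive definiteness of the signless Laplacian turns a saddle into a
   minimum of the network function. *)
pose K : R := #|V|%:R ^+ 2 *+ #|edges adj|.
apply: (@saddle_not_local_min R K); apply: conv.
- exact: saddle_smooth.
- by move=> a b; rewrite /saddle /= addrC [b + a]addrC [b * a]mulrC addrC.
- exact: network_saddle_local_min.
Qed.
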